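(* (IKKT solution $\mathbb{R}^4\times S^2\times S^2$.) Let $Y_L^a,Y_R^a$, $a=1,2,3$, be Hermitian matrices forming two commuting fuzzy spheres, i.e. $$[Y_L^a,Y_L^b]=ic_L\sum_c\varepsilon^{abc}Y_L^c,\quad \sum_aY_L^aY_L^a=R_L^2\mathbf 1,\quad [Y_R^a,Y_R^b]=ic_R\sum_c\varepsilon^{abc}Y_R^c,\quad \sum_aY_R^aY_R^a=R_R^2\mathbf 1,\quad [Y_L^a,Y_R^b]=0,$$ with real constants $c_L,c_R,R_L,R_R$ chosen such that, for some $\xi\in\mathbb{R}$, $\Box_YY=\xi^2Y$ for each of the six matrices $Y\in\{Y_L^a,Y_R^a\}$, where $\Box_Y:=\sum_{a}\big([Y_L^a,[Y_L^a,\cdot\,]]+[Y_R^a,[Y_R^a,\cdot\,]]\big)$. Let $\bar X^0,\dots,\bar X^3$ be Hermitian matrices commuting with all $Y_L^a,Y_R^a$ and satisfying $[\bar X^\mu,\bar X^\nu]=i\theta^{\mu\nu}\mathbf 1$, with $\theta^{\mu\nu}$ a real antisymmetric invertible $4\times4$ matrix, and let $k_0,\dots,k_3\in\mathbb{R}$. Define ten Hermitian matrices by $X^\mu=\bar X^\mu$ for $\mu=0,\dots,3$ and $$X^{2\alpha+2}+iX^{2\alpha+3}=(Y_L^\alpha+iY_R^\alpha)\,e^{ik_\mu\bar X^\mu},\qquad \alpha=1,2,3$$ (sum over $\mu=0,\dots,3$). Set $k\cdot k:=\sum_{\mu,\nu,\mu',\nu'=0}^3\theta^{\mu\mu'}\theta^{\nu\nu'}\eta_{\mu'\nu'}k_\mu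 k_\nu$. If $k\cdot k=-\xi^2$, then these matrices solve the IKKT equations of motion $$\sum_{b,c=0}^{9}\eta_{bc}[X^b,[X^c,X^a]]=0\qquad\text{for all }a=0,\dots,9.$$
   Context: Conventions: $\eta=\mathrm{diag}(-1,1,\dots,1)$ on indices $0,\dots,9$; $\mathbf 1$ is the identity; $\varepsilon^{abc}$ is the Levi-Civita symbol. ''Matrices'' are operators on a separable Hilbert space; when they are unbounded, commutators and all identities are understood algebraically on a common invariant dense domain, so everything may be read as taking place in a unital complex $*$-algebra with involution $\dagger$. For a matrix $Z$ written as $Z=A+iB$ with $A,B$ Hermitian, $A=\tfrac12(Z+Z^\dagger)$ and $B=\tfrac1{2i}(Z-Z^\dagger)$. Plane waves: if $[\bar X^\mu,\bar X^\nu]=i\theta^{\mu\nu}\mathbf 1$, then $e^{ik_\mu \bar X^\mu}$ denotes the usual unitary exponential, satisfying $[e^{ik_\mu \bar X^\mu},\bar X^\eta]=-k_\mu\theta^{\mu\eta}e^{ik_\mu \bar X^\mu}$, and commuting with everything that commutes with all the $\bar X^\mu$. *)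

(* Defs.v *)
From HB Require Import structures.
From mathcomp Require Import all_boot all_order all_algebra.
From mathcomp Require Import reals.
From mathcomp Require Import complex.
Set Implicit Arguments.
Unset Strict Implicit.
Unset Printing Implicit Defensive.
Import GRing.Theory.
Local Open Scope ring_scope.
Local Open Scope complex_scope.

(* Operators on a common invariant dense domain are modelled by the elements  *)
(* of an arbitrary unital associative algebra A over R[i] with an involution. *)
(* Real constants are elements of R, embedded in R[i] by %:C; the scalar      *)
(* multiple of the identity by a is a *: 1.                                   *)

Record is_involution (R : realType) (A : algType R[i]) (dag : A -> A) : Prop :=
  IsInvolution {
    dagD : forall x y, dag (x + y) = dag x + dag y;
    dagZ : forall (a : R[i]) x, dag (a *: x) = conjc a *: dag x;
    dagM : forall x y, dag (x * y) = dag y * dag x;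
    dagK : forall x, dag (dag x) = x }.

Definition self_adjoint (A : Type) (dag : A -> A) (x : A) : Prop := dag x = x.

Definition commutator (A : pzRingType) (x y : A) : A := x * y - y * x.

Definition herm_re (R : realType) (A : algType R[i]) (dag : A -> A) (z : A) : A :=
  (2 : R[i])^-1 *: (z + dag z).

Definition herm_im (R : realType) (A : algType R[i]) (dag : A -> A) (z : A) : A :=
  (2 * 'i%C : R[i])^-1 *: (z - dag z).

Definition eta_metric (R : pzRingType) (n : nat) : 'M[R]_n :=
  diag_mx (\row_i (if (i : nat) == 0%N then -1 else 1)).

(* Additions in 'I_3 are modulo 3, so the two tests single out the even and   *)
(* the odd permutations of the three indices.                                 *)
Definition levi_civita (R : pzRingType) (a b c : 'I_3) : R :=
  if (b == a + 1) && (c == b + 1) then 1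
  else if (a == b + 1) && (b == c + 1) then -1
  else 0.

Record fuzzy_sphere (R : realType) (A : algType R[i]) (dag : A -> A)
    (c r : R) (Y : 'I_3 -> A) : Prop := FuzzySphere {
  fuzzy_herm : forall a, self_adjoint dag (Y a);
  fuzzy_comm : forall a b, commutator (Y a) (Y b)
    = ('i%C * c%:C) *: \sum_(d < 3) (levi_civita R a b d)%:C *: Y d;
  fuzzy_radius : \sum_(a < 3) Y a * Y a = (r ^+ 2)%:C *: 1 }.

Definition box_Y (A : pzRingType) (YL YR : 'I_3 -> A) (x : A) : A :=
  \sum_(a < 3) (commutator (YL a) (commutator (YL a) x)
              + commutator (YR a) (commutator (YR a) x)).

Definition moyal_weyl (R : realType) (A : algType R[i])
    (theta : 'M[R]_4) (Xbar : 'I_4 -> A) : Prop :=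
  forall mu nu, commutator (Xbar mu) (Xbar nu)
    = ('i%C * (theta mu nu)%:C) *: 1.

(* A *-algebra has no exponential, so exp(i k_mu Xbar^mu) is represented by   *)
(* any unitary U with the algebraic properties of the plane wave.             *)
Record plane_wave (R : realType) (A : algType R[i]) (dag : A -> A)
    (theta : 'M[R]_4) (Xbar : 'I_4 -> A) (k : 'I_4 -> R) (U : A) : Prop :=
  PlaneWave {
    plane_wave_unitaryl : dag U * U = 1;
    plane_wave_unitaryr : U * dag U = 1;
    plane_wave_comm : forall nu, commutator U (Xbar nu)
      = (- \sum_(mu < 4) k mu * theta mu nu)%:C *: U;
    plane_wave_central : forall x : A,
      (forall mu, commutator x (Xbar mu) = 0) -> commutator U x = 0 }.

Definition momentum_sq (R : realType) (theta : 'M[R]_4) (k : 'I_4 -> R) : R :=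
  \sum_(mu < 4) \sum_(nu < 4) \sum_(mu' < 4) \sum_(nu' < 4)
    theta mu mu' * theta nu nu' * eta_metric R 4 mu' nu' * k mu * k nu.

(* Numbering alpha from 0 instead of 1, the Hermitian and anti-Hermitian      *)
(* parts of (YL alpha + i YR alpha) U have indices 4 + 2 alpha and            *)
(* 5 + 2 alpha; j below is the index minus 4.                                 *)
Definition ikkt_background (R : realType) (A : algType R[i]) (dag : A -> A)
    (Xbar : 'I_4 -> A) (YL YR : 'I_3 -> A) (U : A) (a : 'I_10) : A :=
  match @split 4 6 a with
  | inl mu => Xbar mu
  | inr j =>
      let alpha : 'I_3 := inord (j : nat)./2 in
      let Z := (YL alpha + 'i%C *: YR alpha) * U in
      if odd j then herm_im dag Z else herm_re dag Z
  end.

Definition ikkt_eom (R : realType) (A : algType R[i]) (X : 'I_10 -> A) : Prop :=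
  forall a : 'I_10,
    \sum_(b < 10) \sum_(c < 10)
      (eta_metric R 10 b c)%:C *: commutator (X b) (commutator (X c) (X a)) = 0.

Lemma complex_i_neq0 (R : realType) : ('i%C : R[i]) != 0.
Proof. by rewrite eq_complex /= oner_eq0 andbF. Qed.

Lemma complex_iV (R : realType) : ('i%C : R[i])^-1 = - 'i%C.
Proof.
apply: (mulfI (complex_i_neq0 R)).
by rewrite mulfV ?complex_i_neq0 // mulrN -expr2 sqr_i opprK.
Qed.

Lemma conjc_half (R : realType) : conjc ((2 : R[i])^-1) = 2^-1.
Proof.
have -> : (2 : R[i])^-1 = (2^-1)%:C by rewrite fmorphV /= rmorph_nat.
exact: conjc_real.
Qed.

Lemma herm_re_hermitian (R : realType) (A : algType R[i]) (dag : A -> A)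
    (dagP : is_involution dag) z : self_adjoint dag (herm_re dag z).
Proof.
rewrite /self_adjoint /herm_re (dagZ dagP) (dagD dagP) (dagK dagP).
by rewrite conjc_half addrC.
Qed.

Lemma herm_im_hermitian (R : realType) (A : algType R[i]) (dag : A -> A)
    (dagP : is_involution dag) z : self_adjoint dag (herm_im dag z).
Proof.
have dagN x : dag (- x) = - dag x.
  rewrite -scaleN1r (dagZ dagP) -[in RHS]scaleN1r; congr (_ *: _).
  by apply/eqP; rewrite eq_complex /= oppr0 oppr0 !eqxx.
rewrite /self_adjoint /herm_im (dagZ dagP) (dagD dagP) dagN (dagK dagP).
have -> : conjc ((2 * 'i%C : R[i])^-1) = - (2 * 'i%C)^-1.
  have -> : (2 * 'i%C : R[i])^-1 = (- 2^-1) *i.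
    rewrite invfM complex_iV.
    have -> : (2 : R[i])^-1 = (2^-1)%:C by rewrite fmorphV /= rmorph_nat.
    by apply/eqP; rewrite eq_complex /= !(oppr0, mulr0, mul0r, mulrN, mulr1, addr0, subr0, subrr) !eqxx.
  by apply/eqP; rewrite eq_complex /= oppr0 !eqxx.
by rewrite scaleNr -scalerN opprD opprK addrC.
Qed.

Lemma herm_re_im (R : realType) (A : algType R[i]) (dag : A -> A) z :
  herm_re dag z + 'i%C *: herm_im dag z = z.
Proof.
rewrite /herm_re /herm_im scalerA invfM mulrCA mulfV ?complex_i_neq0 // mulr1.
rewrite -scalerDr addrACA subrr addr0 -mulr2n.
rewrite -[z *+ 2]scaler_nat scalerA mulVf.
  by rewrite scale1r.
by rewrite Num.Theory.pnatr_eq0.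
Qed.

(* The ten matrices satisfy the conditions that determine them.               *)
Lemma ikkt_background_hermitian (R : realType) (A : algType R[i])
    (dag : A -> A) (dagP : is_involution dag) Xbar YL YR U a :
  (forall mu, self_adjoint dag (Xbar mu)) ->
  self_adjoint dag (ikkt_background dag Xbar YL YR U a).
Proof.
move=> hX; rewrite /ikkt_background; case: split => [mu|j] //=.
by case: odd; [exact: herm_im_hermitian | exact: herm_re_hermitian].
Qed.

Lemma ikkt_background_flat (R : realType) (A : algType R[i]) (dag : A -> A)
    Xbar YL YR U (mu : 'I_4) :
  ikkt_background dag Xbar YL YR U (lshift 6 mu) = Xbar mu.
Proof. by rewrite /ikkt_background (unsplitK (inl mu)). Qed.

Lemma ikkt_background_wave (R : realType) (A : algType R[i]) (dag : A -> A)
    Xbar YL YR U (alpha : 'I_3) (a b : 'I_10) :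
  a = (4 + 2 * alpha)%N :> nat -> b = (5 + 2 * alpha)%N :> nat ->
  ikkt_background dag Xbar YL YR U a + 'i%C *: ikkt_background dag Xbar YL YR U b
    = (YL alpha + 'i%C *: YR alpha) * U.
Proof.
move=> ea eb.
have ltj (e : bool) : (e + alpha.*2 < 6)%N.
  by case: e alpha {ea eb} => -[[|[|[|]]]].
have -> : a = rshift 4 (Ordinal (ltj false)).
  by apply: val_inj; rewrite /= ea mul2n.
have -> : b = rshift 4 (Ordinal (ltj true)).
  by apply: val_inj; rewrite /= eb mul2n.
rewrite /ikkt_background (unsplitK (inr (Ordinal (ltj false)))).
rewrite (unsplitK (inr (Ordinal (ltj true)))) /=.
rewrite odd_double uphalf_double doubleK inord_val.
exact: herm_re_im.
Qed.

(* Main.v *)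
Require Import Defs.
From HB Require Import structures.
From mathcomp Require Import all_boot all_order all_algebra.
From mathcomp Require Import reals.
From mathcomp Require Import complex.
From mathcomp Require Import ring.
Set Implicit Arguments.
Unset Strict Implicit.
Unset Printing Implicit Defensive.
Import GRing.Theory.
Local Open Scope ring_scope.
Local Open Scope complex_scope.

(** Write Z = W U with W = YL + i YR, where U commutes with W. For Z = A + i B
    one has the polarisation
      [A,[A,x]] + [B,[B,x]] = ([Z,[Z',x]] + [Z',[Z,x]]) / 2,   Z' = A - i B,
    and the same identity with (YL, YR, W) in place of (A, B, Z). In
    [Z,[Z',y T]], with T = U or its inverse V = dag U, the factors U and V
    cancel, so the six transverse directions act on y T exactly as box_Y acts
    on y, that is by xi ^ 2 when y = YL +- i YR. The four flat directions act on
    U and V by k.k = - xi ^ 2, and the two contributions cancel. On Xbar the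
    flat directions act by 0 since [Xbar, Xbar] is central, and the transverse
    ones too since [Z', Xbar] is proportional to Z', which commutes with Z. *)

(** * Commutator identities in an associative algebra *)

Section Commutator.
Variables (K : comPzRingType) (A : algType K).
Implicit Types (x y z u v w : A) (c : K).

Lemma commutatorDl x y z : commutator (x + y) z = commutator x z + commutator y z.
Proof. by rewrite /commutator mulrDl mulrDr opprD addrACA. Qed.

Lemma commutatorDr x y z : commutator x (y + z) = commutator x y + commutator x z.
Proof. by rewrite /commutator mulrDl mulrDr opprD addrACA. Qed.

Lemma commutatorZl c x y : commutator (c *: x) y = c *: commutator x y.
Proof. by rewrite /commutator -scalerAl -scalerAr scalerBr. Qed.

Lemma commutatorZr c x y : commutator x (c *: y) = c *: commutator x y.
Proof. by rewrite /commutator -scalerAl -scalerAr scalerBr. Qed.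

Lemma commutator_eq0P x y : commutator x y = 0 <-> GRing.comm x y.
Proof. by split=> [/subr0_eq|h]; rewrite /GRing.comm /commutator // h subrr. Qed.

(** In [w * u * (y * v)] the factor [u] moves past [y], and in [y * v * (w * u)] the factor [v]
    moves past [w], so both products end in [u * v]. This is how wave factors are collected and then
    cancelled. *)
Lemma commutatorM w u y v :
  GRing.comm u w -> GRing.comm u y -> GRing.comm v w -> GRing.comm u v ->
  commutator (w * u) (y * v) = commutator w y * (u * v).
Proof.
move=> uw uy vw uv; rewrite /commutator mulrBl; congr (_ - _).
  by rewrite mulrA -(mulrA w u y) uy !mulrA.
by rewrite mulrA -(mulrA y v w) vw -!mulrA uv.
Qed.

Lemma commutatorMl w u y : GRing.comm w y ->
  commutator (w * u) y = w * commutator u y.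
Proof. by move=> wy; rewrite /commutator mulrBr !mulrA wy. Qed.

Lemma commutatorMr x y v : GRing.comm x y ->
  commutator x (y * v) = y * commutator x v.
Proof. by move=> xy; rewrite /commutator mulrBr !mulrA xy. Qed.

Lemma comm_commutator u x y : GRing.comm u x -> GRing.comm u y ->
  GRing.comm u (commutator x y).
Proof. by move=> ux uy; apply: commrB; apply: commrM. Qed.

(** Multiplying [u, x] = c u by [v] on both sides gives x v - v x = c v: the inverse wave carries
    the opposite momentum. *)
Lemma commutator_inv x u v c : u * v = 1 -> v * u = 1 ->
  commutator u x = c *: u -> commutator v x = - c *: v.
Proof.
move=> uv vu h; have /(congr1 (fun z => v * z * v)) := h.
rewrite /commutator mulrBr mulrBl !mulrA vu mul1r -(mulrA _ u v) uv mulr1.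
by rewrite -scalerAr -scalerAl vu mul1r scaleNr => <-; rewrite opprB.
Qed.

Lemma commutatorNl x y : commutator (- x) y = - commutator x y.
Proof. by rewrite -scaleN1r commutatorZl scaleN1r. Qed.

Lemma commutatorNr x y : commutator x (- y) = - commutator x y.
Proof. by rewrite -scaleN1r commutatorZr scaleN1r. Qed.

Lemma commutator_parallelogram x y z :
  commutator (x + y) (commutator (x - y) z)
  + commutator (x - y) (commutator (x + y) z)
  = (commutator x (commutator x z) - commutator y (commutator y z)) *+ 2.
Proof.
rewrite !(commutatorDl _ _ z) !commutatorNl.
move: (commutator x z) (commutator y z) => p q.
(* Grouped by outer argument, [x] meets (p - q) + (p + q) = 2p and [y] meets (p - q) - (p + q) =
   -2q, so the mixed terms cancel. *)
rewrite !commutatorDl !commutatorNl addrACA -!commutatorNr -!commutatorDr.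
rewrite opprD (addrACA p) addNr addr0 (addrACA p) subrr add0r.
by rewrite !commutatorDr !commutatorNr mulr2n addrACA.
Qed.

(* Iterating commutatorDr instead may split the difference that defines the
   inner commutator. *)
Lemma commutator2D u v x y : commutator u (commutator v (x + y))
  = commutator u (commutator v x) + commutator u (commutator v y).
Proof. by rewrite (commutatorDr v) (commutatorDr u). Qed.

Lemma commutator2Z u v c x :
  commutator u (commutator v (c *: x)) = c *: commutator u (commutator v x).
Proof. by rewrite !commutatorZr. Qed.

End Commutator.


(** * Action of one pair of transverse directions *)

Section TransverseBox.
Variables (R : realType) (A : algType R[i]).
Implicit Types (x y z u v t e f : A).

(** The preceding identity with ['i *: y] for [y]; the square of i turns the difference into a
    sum. *)
Lemma commutator_polarisation x y z :
  commutator (x + 'i *: y) (commutator (x - 'i *: y) z)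
  + commutator (x - 'i *: y) (commutator (x + 'i *: y) z)
  = (commutator x (commutator x z) + commutator y (commutator y z)) *+ 2 :> A.
Proof.
rewrite commutator_parallelogram; congr (_ *+ 2); congr (_ + _).
rewrite !(commutatorZl, commutatorZr) scalerA -expr2 sqr_i.
by rewrite scaleN1r opprK.
Qed.

Lemma mulr2n_inj x y : x *+ 2 = y *+ 2 -> x = y.
Proof.
rewrite -(@scaler_nat R[i] _ _ x) -(@scaler_nat R[i] _ _ y) => /scalerI; apply.
by rewrite Num.Theory.pnatr_eq0.
Qed.

Lemma comm_polar t x y : GRing.comm t x -> GRing.comm t y ->
  GRing.comm t (x + 'i *: y) /\ GRing.comm t (x - 'i *: y).
Proof.
move=> tx ty; have tiy : GRing.comm t ('i *: y).
  by rewrite /GRing.comm -scalerAr -scalerAl ty.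
by split; [apply: commrD | apply: commrB].
Qed.

(** Put W = x + i y and W' = x - i y. Then [W' v, e f] = [W', e] v f, and [W u, [W', e] v f] = [W,
    [W', e]] u v f with u v = 1. The opposite order is symmetric, and polarisation on both sides
    returns to (z1, z2) and (x, y). *)
Lemma transverse_wave x y z1 z2 u v e f :
  z1 + 'i *: z2 = (x + 'i *: y) * u ->
  z1 - 'i *: z2 = (x - 'i *: y) * v ->
  GRing.comm x y -> u * v = 1 -> v * u = 1 ->
  GRing.comm u x -> GRing.comm u y -> GRing.comm v x -> GRing.comm v y ->
  GRing.comm u e -> GRing.comm v e -> GRing.comm f x -> GRing.comm f y ->
  GRing.comm f u -> GRing.comm f v ->
  commutator z1 (commutator z1 (e * f)) + commutator z2 (commutator z2 (e * f))
  = (commutator x (commutator x e) + commutator y (commutator y e)) * f.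
Proof.
move=> zp zm xy uv vu ux uy vx vy ue ve fx fy fu fv; apply: mulr2n_inj.
have [uW uW'] := comm_polar ux uy; have [vW vW'] := comm_polar vx vy.
have [fW fW'] := comm_polar fx fy.
rewrite -commutator_polarisation zp zm -mulrnAl -commutator_polarisation [RHS]mulrDl.
congr (_ + _).
  rewrite (commutatorM vW' ve fW' (commr_sym fv)).
  rewrite commutatorM //; first by rewrite mulrA uv mul1r.
  - exact: comm_commutator.
  - by apply: commr_sym; apply: commrM; apply: commr_sym.
  - by rewrite /GRing.comm -mulrA fu !mulrA uv vu.
rewrite (commutatorM uW ue fW (commr_sym fu)).
rewrite commutatorM //; first by rewrite mulrA vu mul1r.
- exact: comm_commutator.
- by apply: commr_sym; apply: commrM; apply: commr_sym.
- by rewrite /GRing.comm -mulrA fv !mulrA uv vu.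
Qed.

(** Here [e] is to be a flat coordinate. The inner commutators are W [u, e] = c W u and W' [v, e] =
    -c W' v. Since [x] and [y] commute, so do W and W', hence also W u and W' v, and both outer
    commutators vanish. *)
Lemma transverse_central x y z1 z2 u v e c :
  z1 + 'i *: z2 = (x + 'i *: y) * u ->
  z1 - 'i *: z2 = (x - 'i *: y) * v ->
  GRing.comm x y -> u * v = 1 -> v * u = 1 ->
  GRing.comm u x -> GRing.comm u y -> GRing.comm v x -> GRing.comm v y ->
  GRing.comm x e -> GRing.comm y e -> commutator u e = c *: u ->
  commutator z1 (commutator z1 e) + commutator z2 (commutator z2 e) = 0.
Proof.
move=> zp zm xy uv vu ux uy vx vy xe ye ue.
apply: mulr2n_inj; rewrite mul0rn -commutator_polarisation zp zm.
have ve := commutator_inv uv vu ue.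
have [uW uW'] := comm_polar ux uy; have [vW vW'] := comm_polar vx vy.
have [xW xW'] := comm_polar (commr_refl x) xy.
have [yW yW'] := comm_polar (commr_sym xy) (commr_refl y).
have [eW eW'] := comm_polar (commr_sym xe) (commr_sym ye).
have WW' : GRing.comm (x + 'i *: y) (x - 'i *: y).
  by apply: commrB; apply: commr_sym => //; rewrite /GRing.comm -scalerAr -scalerAl yW.
have /commutator_eq0P ZZ' : commutator ((x + 'i *: y) * u) ((x - 'i *: y) * v) = 0.
  rewrite commutatorM ?uv ?mulr1 //; last by rewrite /GRing.comm uv.
  exact/commutator_eq0P.
rewrite (commutatorMl v (commr_sym eW')) (commutatorMl u (commr_sym eW)) ue ve.
rewrite -!scalerAr !commutatorZr.
have /commutator_eq0P-> := ZZ'; have /commutator_eq0P-> := commr_sym ZZ'.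
by rewrite !scaler0 addr0.
Qed.

End TransverseBox.

(** * Contractions with the diagonal metric *)

Section Metric.
Variables (R : realType).

Lemma eta_metricE (K : pzRingType) n (i j : 'I_n) :
  eta_metric K n i j = (if i == 0%N :> nat then -1 else 1) *+ (i == j).
Proof. by rewrite !mxE. Qed.

Lemma sum_eta_metric (A : lmodType R[i]) n (b : 'I_n) (f : 'I_n -> A) :
  \sum_(c < n) (eta_metric R n b c)%:C *: f c = (eta_metric R n b b)%:C *: f b.
Proof.
rewrite (bigD1 b) //= big1 ?addr0 // => c /negbTE cb.
by rewrite eta_metricE (eq_sym b) cb scale0r.
Qed.

(** The squared quantities are, up to sign, the eigenvalues of the flat directions on the plane
    wave, so this is the form in which k.k arises from double commutators. *)
Lemma momentum_sqE (theta : 'M[R]_4) (k : 'I_4 -> R) :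
  momentum_sq theta k
  = \sum_(nu < 4) eta_metric R 4 nu nu * (\sum_(mu < 4) k mu * theta mu nu) ^+ 2.
Proof.
transitivity (\sum_(mu < 4) \sum_(nu < 4) \sum_(s < 4)
    eta_metric R 4 s s * ((k mu * theta mu s) * (k nu * theta nu s))).
  apply: eq_bigr => mu _; apply: eq_bigr => nu _; apply: eq_bigr => s _.
  rewrite (bigD1 s) //= big1 ?addr0 => [|t /negbTE ts]; first by ring.
  by rewrite eta_metricE (eq_sym s) ts mulr0 !mul0r.
(* Two exchanges bring the metric index [s] outermost; the remaining double sum factors as a
   square. *)
rewrite (eq_bigr _ (fun _ _ => exchange_big _ _ _ _ _ _)) exchange_big /=.
apply: eq_bigr => s _; rewrite expr2 big_distrlr /= mulr_sumr.
by apply: eq_bigr => mu _; rewrite mulr_sumr.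
Qed.

End Metric.

(** Pairs the even and odd transverse indices, which carry the two Hermitian parts of one complex
    matrix. Taking [F] on [nat] avoids bound proofs for the doubled indices. *)
Lemma sum_double (V : nmodType) n (F : nat -> V) :
  \sum_(j < n.*2) F j = \sum_(a < n) (F a.*2 + F a.*2.+1).
Proof.
by elim: n => [|n IHn]; rewrite ?big_ord0 // doubleS !big_ord_recr /= IHn addrA.
Qed.

Lemma ikkt_backgroundE (R : realType) (A : algType R[i]) (dag : A -> A)
    (Xbar : 'I_4 -> A) (YL YR : 'I_3 -> A) (U : A) (j : 'I_6) :
  ikkt_background dag Xbar YL YR U (rshift 4 j) =
    let alpha := inord j./2 in
    let Z := (YL alpha + 'i *: YR alpha) * U in
    if odd j then herm_im dag Z else herm_re dag Z.
Proof. by rewrite /ikkt_background (unsplitK (inr j)). Qed.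

(** * Adjoints of complex combinations of Hermitian matrices *)

Section Involution.
Variables (R : realType) (A : algType R[i]) (dag : A -> A).
Hypothesis dagP : is_involution dag.
Implicit Types (x y z : A).

Lemma conjc_i : conjc ('i : R[i]) = - 'i.
Proof. by apply/eqP; rewrite eq_complex /= oppr0 !eqxx. Qed.

Lemma dag_polar x y : self_adjoint dag x -> self_adjoint dag y ->
  dag (x + 'i *: y) = x - 'i *: y.
Proof.
by move=> hx hy; rewrite (dagD dagP) (dagZ dagP) hx hy conjc_i scaleNr.
Qed.

Lemma herm_re_im_dag z : herm_re dag z - 'i *: herm_im dag z = dag z.
Proof.
rewrite -[in RHS](herm_re_im dag z) dag_polar //.
- exact: herm_re_hermitian.
- exact: herm_im_hermitian.
Qed.

(** The adjoint of the relation x y = y x; it carries commutation from the wave to its inverse. *)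
Lemma comm_dag x y : self_adjoint dag y -> GRing.comm x y -> GRing.comm (dag x) y.
Proof.
by move=> hy xy; rewrite /GRing.comm -{1}hy -{2}hy -!(dagM dagP) xy.
Qed.

End Involution.

(** * Box operators: linearity, splitting into flat and transverse parts, action on waves *)

Lemma box_Y_polar (R : realType) (A : algType R[i]) (YL YR : 'I_3 -> A)
    (c d : R[i]) x y :
  box_Y YL YR x = c *: x -> box_Y YL YR y = c *: y ->
  box_Y YL YR (x + d *: y) = c *: (x + d *: y).
Proof.
move=> hx hy; rewrite scalerDr scalerA mulrC -scalerA -hx -hy /box_Y.
rewrite scaler_sumr -big_split /=; apply: eq_bigr => a _.
by rewrite !(commutator2D _ _ x) !(commutator2Z _ _ d) addrACA -scalerDr.
Qed.

(** The matrix d'Alembertian of the background, with the diagonal metric already contracted. As a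
    linear operator it can be evaluated on Z and its adjoint instead of on their Hermitian parts. *)
Definition ikkt_box (R : realType) (A : algType R[i]) (X : 'I_10 -> A) (x : A) : A :=
  \sum_(b < 10) (eta_metric R 10 b b)%:C *: commutator (X b) (commutator (X b) x).

Lemma ikkt_eomE (R : realType) (A : algType R[i]) (X : 'I_10 -> A) :
  (forall a, ikkt_box X (X a) = 0) -> ikkt_eom X.
Proof.
move=> h a; rewrite -[RHS](h a); apply: eq_bigr => b _.
exact: (sum_eta_metric _ (fun c => commutator (X b) (commutator (X c) (X a)))).
Qed.

Lemma ikkt_boxZ (R : realType) (A : algType R[i]) (X : 'I_10 -> A) c x :
  ikkt_box X (c *: x) = c *: ikkt_box X x.
Proof.
rewrite /ikkt_box scaler_sumr; apply: eq_bigr => b _.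
by rewrite commutator2Z !scalerA mulrC.
Qed.

Lemma ikkt_boxD (R : realType) (A : algType R[i]) (X : 'I_10 -> A) x y :
  ikkt_box X (x + y) = ikkt_box X x + ikkt_box X y.
Proof.
rewrite /ikkt_box -big_split; apply: eq_bigr => b _.
by rewrite (commutator2D _ _ x) (scalerDr _ (commutator _ _)).
Qed.

Lemma ikkt_box_background (R : realType) (A : algType R[i]) (dag : A -> A)
    (Xbar : 'I_4 -> A) (YL YR : 'I_3 -> A) (U x : A) :
  let Z a := (YL a + 'i *: YR a) * U in
  ikkt_box (ikkt_background dag Xbar YL YR U) x =
    \sum_(mu < 4) (eta_metric R 4 mu mu)%:C *:
      commutator (Xbar mu) (commutator (Xbar mu) x)
    + \sum_(a < 3)
        (commutator (herm_re dag (Z a)) (commutator (herm_re dag (Z a)) x)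
       + commutator (herm_im dag (Z a)) (commutator (herm_im dag (Z a)) x)).
Proof.
move=> Z; rewrite /ikkt_box (@big_split_ord _ _ _ 4 6) /=; congr (_ + _).
  by apply: eq_bigr => mu _; rewrite ikkt_background_flat !eta_metricE !eqxx.
pose F j := let z := Z (inord j./2) in
  let h := if odd j then herm_im dag z else herm_re dag z in
  commutator h (commutator h x).
transitivity (\sum_(j < 6) F j).
  by apply: eq_bigr => j _; rewrite ikkt_backgroundE eta_metricE eqxx scale1r.
rewrite (sum_double 3 F); apply: eq_bigr => a _.
by rewrite /F /= odd_double uphalf_double doubleK inord_val.
Qed.

(** The factor [y] is inert, so each flat direction acts twice on [t] alone, each time multiplying
    by [p mu]. *)
Lemma flat_wave (R : realType) (A : algType R[i]) (Xbar : 'I_4 -> A)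
    (p : 'I_4 -> R) (y t : A) :
  (forall mu, GRing.comm (Xbar mu) y) ->
  (forall mu, commutator (Xbar mu) t = (p mu)%:C *: t) ->
  \sum_(mu < 4) (eta_metric R 4 mu mu)%:C *:
      commutator (Xbar mu) (commutator (Xbar mu) (y * t))
  = (\sum_(mu < 4) eta_metric R 4 mu mu * p mu ^+ 2)%:C *: (y * t).
Proof.
move=> Xy Xt; rewrite rmorph_sum scaler_suml; apply: eq_bigr => mu _.
rewrite commutatorMr // Xt -scalerAr commutatorZr commutatorMr // Xt -scalerAr.
by rewrite !scalerA rmorphM rmorphXn expr2 mulrA.
Qed.

(** * The equations of motion for the background *)

Theorem mainTheorem5 (R : realType) (A : algType R[i]) (dag : A -> A)
    (dagP : is_involution dag)
    (cL cR rL rR xi : R) (YL YR : 'I_3 -> A)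
    (YL_sphere : fuzzy_sphere dag cL rL YL)
    (YR_sphere : fuzzy_sphere dag cR rR YR)
    (YL_YR : forall a b, commutator (YL a) (YR b) = 0)
    (box_YL : forall a, box_Y YL YR (YL a) = (xi ^+ 2)%:C *: YL a)
    (box_YR : forall a, box_Y YL YR (YR a) = (xi ^+ 2)%:C *: YR a)
    (theta : 'M[R]_4)
    (theta_antisym : theta^T = - theta)
    (theta_unit : theta \in unitmx)
    (Xbar : 'I_4 -> A)
    (Xbar_herm : forall mu, self_adjoint dag (Xbar mu))
    (Xbar_YL : forall mu a, commutator (Xbar mu) (YL a) = 0)
    (Xbar_YR : forall mu a, commutator (Xbar mu) (YR a) = 0)
    (Xbar_comm : moyal_weyl theta Xbar)
    (k : 'I_4 -> R) (U : A)
    (U_wave : plane_wave dag theta Xbar k U)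
    (kk : momentum_sq theta k = - xi ^+ 2) :
  ikkt_eom (ikkt_background dag Xbar YL YR U).
Proof.
pose p nu := \sum_(mu < 4) k mu * theta mu nu.
set V := dag U; have VU : V * U = 1 := plane_wave_unitaryl U_wave.
have UV : U * V = 1 := plane_wave_unitaryr U_wave.
have UX nu : commutator U (Xbar nu) = (- p nu)%:C *: U.
  exact: plane_wave_comm U_wave nu.
have VX nu : commutator V (Xbar nu) = (p nu)%:C *: V.
  by rewrite (commutator_inv UV VU (UX nu)) -rmorphN opprK.
have hL := fuzzy_herm YL_sphere; have hR := fuzzy_herm YR_sphere.
have XL mu a : GRing.comm (Xbar mu) (YL a) by apply/commutator_eq0P.
have XR mu a : GRing.comm (Xbar mu) (YR a) by apply/commutator_eq0P.
(* The wave commutes with the spheres because they commute with every flat coordinate. *)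
have UL a : GRing.comm U (YL a).
  apply/commutator_eq0P/(plane_wave_central U_wave) => mu.
  exact/commutator_eq0P/commr_sym.
have UR a : GRing.comm U (YR a).
  apply/commutator_eq0P/(plane_wave_central U_wave) => mu.
  exact/commutator_eq0P/commr_sym.
have VL a : GRing.comm V (YL a) by exact: comm_dag (hL a) (UL a).
have VR a : GRing.comm V (YR a) by exact: comm_dag (hR a) (UR a).
have LR a b : GRing.comm (YL a) (YR b) by apply/commutator_eq0P.
pose Z a := (YL a + 'i *: YR a) * U.
(* The adjoint reverses the product, and [V] is then moved back to the right of the sphere
   factor. *)
have dagZ a : dag (Z a) = (YL a - 'i *: YR a) * V.
  rewrite (dagM dagP) dag_polar // -/V.
  by have [_ ->] := comm_polar (VL a) (VR a).
have Zp a := herm_re_im dag (Z a).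
have Zm a := etrans (herm_re_im_dag dagP (Z a)) (dagZ a).
pose box := ikkt_box (ikkt_background dag Xbar YL YR U).
(* Covers both waves at once: [f] is [U] with momentum [p] or [V] with momentum [- p], and only the
   squares of the momenta enter. *)
have box_wave y f (q : 'I_4 -> R) :
    (forall mu, GRing.comm (Xbar mu) y) -> GRing.comm U y -> GRing.comm V y ->
    (forall a, GRing.comm f (YL a)) -> (forall a, GRing.comm f (YR a)) ->
    GRing.comm f U -> GRing.comm f V ->
    box_Y YL YR y = (xi ^+ 2)%:C *: y ->
    (forall mu, commutator (Xbar mu) f = (q mu)%:C *: f) ->
    (forall mu, q mu ^+ 2 = p mu ^+ 2) -> box (y * f) = 0.
  move=> Xy Uy Vy fL fR fU fV boxy Xf qp.
  rewrite /box ikkt_box_background (flat_wave Xy Xf) (eq_bigr _ (fun a _ =>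
    transverse_wave (Zp a) (Zm a) (LR a a) UV VU (UL a) (UR a) (VL a) (VR a)
      Uy Vy (fL a) (fR a) fU fV)).
  rewrite -mulr_suml -/(box_Y _ _ _) boxy -scalerAl -scalerDl -rmorphD.
  under eq_bigr do rewrite qp.
  (* The flat eigenvalue k.k and the transverse eigenvalue [xi ^+ 2] add up to zero. *)
  by rewrite -momentum_sqE kk addNr scale0r.
have boxX nu : box (Xbar nu) = 0.
  rewrite /box ikkt_box_background !big1 ?addr0 // => [a|mu] _.
    exact: (transverse_central (Zp a) (Zm a) (LR a a) UV VU
      (UL a) (UR a) (VL a) (VR a)
      (commr_sym (XL nu a)) (commr_sym (XR nu a)) (UX nu)).
  rewrite Xbar_comm commutatorZr /commutator mulr1 mul1r subrr.
  by rewrite !scaler0.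
have boxZ a : box (Z a) = 0.
  apply: (box_wave _ _ p) => // [mu|||||mu].
  - by have [] := comm_polar (XL mu a) (XR mu a).
  - by have [] := comm_polar (UL a) (UR a).
  - by have [] := comm_polar (VL a) (VR a).
  - by rewrite /GRing.comm UV.
  - exact: box_Y_polar.
  - by rewrite -[LHS]opprB -/(commutator U _) UX rmorphN scaleNr opprK.
have boxdZ a : box (dag (Z a)) = 0.
  rewrite dagZ; apply: (box_wave _ _ (fun mu => - p mu)) => // [mu|||||mu|mu].
  - by have [] := comm_polar (XL mu a) (XR mu a).
  - by have [] := comm_polar (UL a) (UR a).
  - by have [] := comm_polar (VL a) (VR a).
  - by rewrite /GRing.comm UV.
  - by rewrite -scaleNr; apply: box_Y_polar.
  - by rewrite -[LHS]opprB -/(commutator V _) VX rmorphN scaleNr.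
  - by rewrite sqrrN.
(* Each transverse matrix is a linear combination of some [Z] and its adjoint, both annihilated by
   [box]. *)
apply: ikkt_eomE => a; rewrite -/(box _).
case: (@split_ordP 4 6 a) => [mu|j] ->; first by rewrite ikkt_background_flat.
rewrite ikkt_backgroundE /= -/(Z _); set b := inord _.
case: odd; rewrite /herm_im /herm_re /box ikkt_boxZ ikkt_boxD -!/(box _).
  rewrite -[- dag _]scaleN1r /box ikkt_boxZ -!/(box _) boxZ boxdZ.
  by rewrite scaler0 addr0 scaler0.
by rewrite boxZ boxdZ addr0 scaler0.
Qed.
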